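(* Let $\lambda>-1$, $t\in\mathbb{R}$, let $m\ge2$ be an integer, and let $\{P_n\}_{n\ge0}$ be the monic orthogonal polynomials with respect to $\omega(x)=|x|^{2\lambda+1}\exp(tx^2-x^{2m})$ on $\mathbb{R}$, with recurrence coefficients $\beta_n$. Then for all $n\ge0$ the recurrence coefficients satisfy the discrete equation $$2m\,V_n^{(2m)}-2t\beta_n=n+\left(\lambda+\tfrac12\right)\left[1-(-1)^n\right],$$ where $$V_n^{(2m)}=C_{n,n-2}^{(2m-2)}+\beta_n\,C_{n,n}^{(2m-2)}.$$
   Context: The polynomials satisfy $P_{n+1}(x)=xP_n(x)-\beta_nP_{n-1}(x)$, $P_{-1}=0$, $P_0=1$, with $\beta_n>0$ for $n\ge1$ and the convention $\beta_0=0$. Let $h_n=\int_{-\infty}^\infty P_n^2(x)\,\omega(x)\,dx>0$. For integers $j\ge1$ the coefficients $C^{(2j)}_{n,k}$ are defined by $x^{2j}P_n(x)=\sum_{\ell=-j}^{j}C^{(2j)}_{n,n+2\ell}P_{n+2\ell}(x)$, i.e. $C^{(2j)}_{n,k}=\frac1{h_k}\int_{-\infty}^\infty x^{2j}P_k(x)P_n(x)\,\omega(x)\,dx$ for $k\ge0$, and $C^{(2j)}_{n,k}=0$ for $k<0$. Thus $V_n^{(2m)}=\frac{1}{h_{n-2}}\int x^{2m-2}P_{n-2}P_n\,\omega\,dx+\frac{\beta_n}{h_n}\int x^{2m-2}P_n^2\,\omega\,dx$ (first term absent if $n<2$). *)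

(* Defs.v *)
From mathcomp Require Import all_boot all_order all_algebra.
From mathcomp Require Import all_classical all_reals all_analysis.
Set Implicit Arguments.
Unset Strict Implicit.
Unset Printing Implicit Defensive.
Import Order.TTheory GRing.Theory Num.Theory.
Local Open Scope ring_scope.

(* At [x = 0] the library sets [0 `^ a = 0] for [a != 0]; for a negative
   exponent this changes the weight on a null set only. *)
Definition weight (R : realType) (lam t : R) (m : nat) (x : R) : R :=
  `|x| `^ (2 * lam + 1) * expR (t * x ^+ 2 - x ^+ (2 * m)).

(* The integral of [p * w] over the real line (Lebesgue). *)
Definition moment (R : realType) (w : R -> R) (p : {poly R}) : R :=
  \int[@lebesgue_measure R]_x (p.[x] * w x).

Definition monic_orthogonal (R : realType) (w : R -> R) (P : nat -> {poly R})
    : Prop :=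
  [/\ forall n, P n \is monic,
      forall n, size (P n) = n.+1
    & forall i j, i != j -> moment w (P i * P j) = 0].

(* The [if] encodes the convention [P_{-1} = 0]. *)
Definition recurrence_coefs (R : realType) (P : nat -> {poly R})
    (beta : nat -> R) : Prop :=
  beta 0%N = 0 /\
  forall n, P n.+1 = 'X * P n - beta n *: (if n is n'.+1 then P n' else 0).

Definition sqnorm (R : realType) (w : R -> R) (P : nat -> {poly R}) (n : nat)
    : R :=
  moment w (P n ^+ 2).

(* [Ccoef w P s n k] is C^{(s)}_{n,k}, the coefficient of [P_k] in the
   expansion of [x^s P_n]; the index [k] is an integer, and the coefficient
   vanishes for [k < 0]. *)
Definition Ccoef (R : realType) (w : R -> R) (P : nat -> {poly R})
    (s n : nat) (k : int) : R :=
  if k is Posz k' then (sqnorm w P k')^-1 * moment w ('X^s * P k' * P n)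
  else 0.

Definition Vcoef (R : realType) (w : R -> R) (P : nat -> {poly R})
    (beta : nat -> R) (m n : nat) : R :=
  Ccoef w P (2 * m - 2) n (n%:Z - 2) + beta n * Ccoef w P (2 * m - 2) n n%:Z.

(* Main.v *)
From HB Require Import structures.
Require Import Defs.
From mathcomp Require Import all_boot all_order all_algebra.
From mathcomp Require Import all_classical all_reals all_analysis.
From mathcomp Require Import measurable_realfun ring lra.
Import Order.TTheory GRing.Theory Num.Theory.
Import numFieldNormedType.Exports.
Local Open Scope ring_scope.

(** The weight [w] satisfies the Pearson equation
    [(x w)' = (2 lam + 2 + 2 t x^2 - 2 m x^(2m)) w] away from the origin, and
    [x w] vanishes at [0] (because [2 lam + 2 > 0]) and at infinity.
    Integrating [(x p w)'] over the line therefore shows that the functional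
    [L p = moment w p] kills
    [(2 lam + 1) p + (x p)' + (2 t x^2 - 2 m x^(2m)) p] for every polynomial
    [p]; this is [moment_pearson].

    The discrete equation is this identity for [x p = P_n P_(n-1)].  Exactly
    one of the two factors has odd degree, and the recurrence makes it vanish
    at [0], so the product is divisible by [x].  By orthogonality, with
    [h_k = L (P_k^2)]:
    - [L p] is [h_(n-1)] for odd [n] (then [P_n / x] is monic of degree
      [n - 1]) and [0] for even [n]; this produces the term with [(-1)^n];
    - [L ((P_n P_(n-1))')] is [n h_(n-1)];
    - [L (x^2 p)] is [h_n = beta_n h_(n-1)];
    - [L (x^(2m) p)] becomes, on replacing [x P_(n-1)] by
      [P_n + beta_(n-1) P_(n-2)] and dividing by [h_(n-1)], the quantity
      [V_n].
    Division by [h_(n-1)] and [h_(n-2)] is legitimate since [L (p^2)] is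
    nonzero for [p != 0] ([moment_sqr_neq0]).

    The analytic input is reduced to the half-line [x > 0] by the symmetry of
    [w].  There, integrability of [p w] comes from comparison with the
    derivative of the bounded function [(x / (1 + x))^(2 lam + 2)], which has
    the same singularity at [0] as [w]. *)

(** * Improper integrals over the open half-line *)

Section HalfLine.
Local Open Scope classical_set_scope.
Local Open Scope ring_scope.
Variable R : realType.
Notation mu := (@lebesgue_measure R).
Notation Rpos := (`]0, +oo[%classic : set R).

(* Compact intervals exhausting the half-line: a derivative with an integrable
   singularity at the origin is continuous on each of them. *)
Let K (n : nat) : set R := `[n.+1%:R^-1, n.+2%:R].

Let K_bound n : n.+1%:R^-1 < n.+2%:R :> R.
Proof.
by rewrite (@le_lt_trans _ _ 1)// ?invf_le1 ?ler1n ?ltr1n// ltr0n.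
Qed.

Let K_pos n x : K n x -> 0 < x.
Proof. by rewrite /K /= in_itv /= => /andP[+ _]; apply: lt_le_trans. Qed.

Let K_nondecreasing : nondecreasing_seq K.
Proof.
apply/nondecreasing_seqP => n; rewrite subsetEset => x.
rewrite /K /= !in_itv /= => /andP[nx xn]; apply/andP; split.
  by apply: le_trans nx; rewrite lef_pV2 ?posrE// ler_nat.
by apply: le_trans xn _; rewrite ler_nat.
Qed.

Let K_eventually x : 0 < x -> \forall n \near \oo, K n x.
Proof.
move=> x0; near=> n; rewrite /K /= in_itv /=; apply/andP; split.
  rewrite -[x]invrK lef_pV2 ?posrE ?invr_gt0// -natr1 ler_wpDr//.
  by near: n; exact: nbhs_infty_ger.
rewrite -addn2 natrD ler_wpDr//.
by near: n; exact: nbhs_infty_ger.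
Unshelve. all: by end_near. Qed.

Let bigcup_K : \bigcup_n K n = Rpos.
Proof.
apply/seteqP; split => [x [n _ /K_pos x0]|x /=]; first by
  rewrite /= in_itv /= x0.
rewrite in_itv/= andbT => /K_eventually[n _ nK]; exists n => //.
exact: (nK n (leqnn n)).
Qed.

Variables (F f : R -> R).
Hypothesis F_f : forall x : R, 0 < x -> is_derive x 1 F (f x).
Hypothesis f_cont : forall x : R, 0 < x -> {for x, continuous f}.

Let F_cont (x : R) : 0 < x -> {for x, continuous F}.
Proof.
by move=> /F_f ?; apply: differentiable_continuous; exact/derivable1_diffP.
Qed.

Let f_contK n : {within K n, continuous f}.
Proof.
apply: continuous_in_subspaceT => x; rewrite inE => /K_pos; exact: f_cont.
Qed.

Let mf : measurable_fun Rpos f.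
Proof.
apply: open_continuous_measurable_fun; first exact: interval_open.
by move=> x; rewrite inE/= in_itv/= andbT => /f_cont.
Qed.

Let integral_K n :
  (\int[mu]_(x in K n) (f x)%:E = (F n.+2%:R - F n.+1%:R^-1)%:E)%E.
Proof.
rewrite EFinB; apply: continuous_FTC2 (f_contK n) _ _; first exact: K_bound.
  split=> [x|| ].
  - by rewrite in_itv/= => /andP[nx _]; have [] := F_f x (lt_trans _ nx).
  - exact/cvg_at_right_filter/F_cont.
  - exact/cvg_at_left_filter/F_cont.
move=> x; rewrite in_itv/= => /andP[nx _]; rewrite derive1E.
by have [|_ ->] := F_f x (lt_trans _ nx).
Qed.

(** The integrals over the compact intervals are increments of [F], hence
    bounded by [2 M]; monotone convergence passes to the half-line. *)
Lemma integrable_bounded_primitive (M : R) : (forall x, 0 < x -> 0 <= f x) ->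
  (forall x, 0 < x -> `|F x| <= M) ->
  mu.-integrable Rpos (EFin \o f).
Proof.
move=> f0 FM; apply/integrableP; split; first exact/measurable_EFinP.
under eq_integral => x.
  rewrite inE /= in_itv/= andbT => x0.
  rewrite ger0_norm ?f0//; over.
rewrite -bigcup_K.
apply: (@le_lt_trans _ _ (2 * M)%:E); last by rewrite ltry.
have cvgK : (\int[mu]_(x in K n) (f x)%:E)%E @[n --> \oo]
    --> (\int[mu]_(x in \bigcup_n K n) (f x)%:E)%E.
  apply: ge0_nondecreasing_set_cvg_integral => //.
  - by move=> n; exact: measurable_itv.
  - move=> n; apply/measurable_EFinP; apply: measurable_funS mf => //.
    by move=> x /K_pos x0 /=; rewrite in_itv/= x0.
  - by move=> n x /K_pos x0; rewrite lee_fin f0.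
apply: cvge_le cvgK; apply: nearW => n; rewrite integral_K lee_fin.
rewrite (le_trans (ler_norm _))// (le_trans (ler_normB _ _))//.
by rewrite mulr_natl mulr2n lerD// FM.
Qed.

(** The integrand may change sign and be unbounded at [0], so the limit over the
    compact intervals is taken by dominated convergence, with [|f|] itself as
    the dominating function. *)
Lemma Rintegral_derivative (l0 l : R) : mu.-integrable Rpos (EFin \o f) ->
  F x @[x --> 0^'+] --> l0 -> F x @[x --> +oo] --> l ->
  \int[mu]_(x in Rpos) f x = l - l0.
Proof.
move=> fi F0 Fy.
pose g n := (EFin \o f) \_ (K n).
have : (\int[mu]_(x in Rpos) g n x)%E @[n --> \oo]
     --> (\int[mu]_(x in Rpos) (f x)%:E)%E.
  apply: (@dominated_cvg _ _ _ mu _ _ g (EFin \o f)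
    (abse \o (EFin \o f))) => //.
  - move=> n; apply/measurable_restrict => //; first exact: measurable_itv.
    by apply/measurable_EFinP; apply: measurable_funS mf.
  - move=> x /=; rewrite in_itv/= andbT => x0; apply: cvg_near_cst.
    have := K_eventually _ x0; apply: filterS => n Kn.
    by rewrite /g patchT// inE.
  - exact: integrable_abse.
  - move=> n x _; rewrite /g patchE; case: ifP => //= _.
    by rewrite normr0 lee_fin.
have gK n : (\int[mu]_(x in Rpos) g n x = (F n.+2%:R - F n.+1%:R^-1)%:E)%E.
  rewrite -integral_K /g -integral_mkcondr.
  congr (integral _ _ _); apply/seteqP; split=> [x []//|x Kx]; split => //.
  by rewrite /= in_itv/= (K_pos _ _ Kx).
under eq_cvg do rewrite gK.
move=> I1.
have I2 : (F n.+2%:R - F n.+1%:R^-1)%:E @[n --> \oo] --> (l - l0)%:E.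
  apply: cvg_EFin; first exact: nearW.
  apply: cvgB.
    apply: (cvg_comp _ F _ Fy).
    apply/cvgryPge => A; near=> n; rewrite -addn2 natrD ler_wpDr//.
    by near: n; exact: nbhs_infty_ger.
  apply: (cvg_at_rightP F 0 l0).1 => //; split => [n|].
    by rewrite /= invr_gt0.
  exact: cvg_harmonic.
by rewrite /Rintegral -(cvg_lim _ I1)// (cvg_lim _ I2).
Unshelve. all: by end_near. Qed.

End HalfLine.

(** * Folding the real line onto the half-line *)

Section Reflection.
Local Open Scope classical_set_scope.
Local Open Scope ring_scope.
Variable R : realType.
Notation mu := (@lebesgue_measure R).
Notation Rpos := (`]0, +oo[%classic : set R).
Notation Rneg := (`]-oo, 0[%classic : set R).
Notation Rnneg := (`[0, +oo[%classic : set R).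

(** Lebesgue measure is its own image under [x |-> - x], so this is a change of
    variables for the pushforward measure.  Measurability is the right level of
    regularity here: the weight may blow up at the origin. *)
Lemma integrable_reflect (f : R -> R) : measurable_fun [set: R] f ->
  mu.-integrable Rpos (fun x => (f (- x))%:E) ->
  mu.-integrable Rneg (EFin \o f) /\
  (\int[mu]_(x in Rneg) (f x)%:E = \int[mu]_(x in Rpos) (f (- x))%:E)%E.
Proof.
move=> mf fi.
have ER : Rpos = (-%R : _ -> measurableTypeR R) @^-1` Rneg.
  by apply/seteqP; split=> x; rewrite /= !in_itv/= andbT oppr_lt0.
have mopp : measurable_fun [set: measurableTypeR R]
    (-%R : _ -> measurableTypeR R).
  exact: oppr_measurable.
have mfE : measurable_fun [set: measurableTypeR R] (EFin \o f).
  exact/measurable_EFinP.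
rewrite ER in fi *.
pose opp : measurableTypeR R -> measurableTypeR R := -%R.
have eqN (h : R -> \bar R) :
    (\int[pushforward mu opp]_(x in Rneg) h x = \int[mu]_(x in Rneg) h x)%E.
  by apply: eq_measure_integral => A mA _; exact: lebesgue_measureN.
have fi' := integrable_pushforward mopp mfE fi (measurable_itv _).
split; last first.
  by rewrite -(integral_pushforward mopp mfE fi (measurable_itv _)) eqN.
apply/integrableP; split; first by have [] := integrableP _ _ _ fi'.
by rewrite -eqN; have [] := integrableP _ _ _ fi'.
Qed.

Lemma Rintegral_symmetrize (f : R -> R) : measurable_fun [set: R] f ->
  mu.-integrable Rpos (EFin \o f) ->
  mu.-integrable Rpos (fun x => (f (- x))%:E) ->
  mu.-integrable [set: R] (EFin \o f) /\
  \int[mu]_x f x = \int[mu]_(x in Rpos) (f x + f (- x)).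
Proof.
move=> mf fp fn; have [fN fNE] := integrable_reflect _ mf fn.
have RT : [set: R] = Rnneg `|` Rneg.
  apply/seteqP; split=> x //= _; rewrite !in_itv/= andbT.
  by case: ltP; [right|left].
have Rd : [disjoint Rnneg & Rneg].
  by apply/disj_setPS => x /=; rewrite !in_itv/= andbT => -[]; case: ltP.
have mfE : measurable_fun [set: R] (EFin \o f) by exact/measurable_EFinP.
have fi : mu.-integrable [set: R] (EFin \o f).
  apply/integrableP; split => //.
  rewrite RT ge0_integral_setU//=; last first.
    by apply: measurable_funTS; apply/measurable_EFinP; exact: measurableT_comp.
  have [_ fNoo] := integrableP _ _ _ fN.
  have [_ fpoo] := integrableP _ _ _ fp.
  rewrite lte_add_pinfty// -integral_itv_obnd_cbnd//.
  by apply: measurable_funTS; apply/measurable_EFinP; exact: measurableT_comp.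
split => //.
have fnn : mu.-integrable Rnneg (EFin \o f).
  by apply: integrableS fi => //; exact: measurable_itv.
rewrite RT Rintegral_setU// -?RT// RintegralD//.
by rewrite -Rintegral_itv_obnd_cbnd// /Rintegral fNE.
Qed.

End Reflection.

(** * Growth of polynomials against the exponential factor *)

Section Growth.
Variable R : realType.

(** Since [x^(2m) >= x^4 - 1] for [m >= 2], the exponent is at most a quartic
    with negative leading coefficient. *)
Lemma exponent_bounded (c t : R) (m : nat) : (2 <= m)%N ->
  exists M, forall x, 0 <= x -> c * x + t * x ^+ 2 - x ^+ (2 * m) <= M.
Proof.
(* The bound comes from [2 c x <= c^2 + x^2] and
   [2 (t + 1) x^2 <= (t + 1)^2 + x^4]. *)
move=> m2; exists (c ^+ 2 + (t + 1) ^+ 2 + 1) => x x0.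
have x4 : x ^+ 4 - 1 <= x ^+ (2 * m).
  have [x1|/ltW x1] := leP x 1.
    by rewrite (@le_trans _ _ 0) ?exprn_ge0// subr_le0 exprn_ile1.
  rewrite (@le_trans _ _ (x ^+ 4)) ?gerBl//.
  by rewrite ler_weXn2l// -[4%N]/(2 * 2)%N leq_mul2l.
have : 0 <= (c - x) ^+ 2 by exact: sqr_ge0.
have : 0 <= (t + 1 - x ^+ 2) ^+ 2 by exact: sqr_ge0.
have : 0 <= (t + 1) ^+ 2 by exact: sqr_ge0.
have : 0 <= c ^+ 2 by exact: sqr_ge0.
have : x ^+ 4 = (x ^+ 2) ^+ 2 by rewrite -exprM.
have : 0 <= x ^+ 2 by exact: sqr_ge0.
nra.
Qed.

(** The linear term [c x] makes the induction on [p] work: a factor [x] is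
    absorbed by raising [c] by one.  It also leaves room for real powers of [x],
    which [powR_le_expR] bounds by exponentials. *)
Lemma poly_exponential_bounded (p : {poly R}) (c t : R) (m : nat) :
  (2 <= m)%N ->
  exists C, forall x, 0 <= x ->
    `|p.[x]| * expR (c * x + t * x ^+ 2 - x ^+ (2 * m)) <= C.
Proof.
move=> m2; elim/poly_ind: p c => [|p d IHp] c.
  by exists 0 => x _; rewrite horner0 normr0 mul0r.
have [C HC] := IHp (c + 1); have [M HM] := exponent_bounded c t m m2.
exists (C + `|d| * expR M) => x x0.
rewrite hornerD hornerM hornerX hornerC.
rewrite (le_trans (ler_wpM2r (expR_ge0 _) (ler_normD _ _)))//.
rewrite mulrDl lerD// ?ler_wpM2l ?ler_expR ?HM//.
apply: le_trans (HC x x0); rewrite normrM -mulrA ler_wpM2l// ger0_norm//.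
apply: (@le_trans _ _ (expR x * expR (c * x + t * x ^+ 2 - x ^+ (2 * m)))).
  by rewrite ler_wpM2r ?expR_ge0// (le_trans _ (expR_ge1Dx _))// lerDr.
by rewrite -expRD ler_expR; lra.
Qed.

Lemma powR_le_expR (x b : R) : 0 < x -> 0 <= b -> x `^ b <= expR (b * x).
Proof.
move=> x0 b0; rewrite /powR gt_eqF// ler_expR ler_wpM2l//.
have := @le_ln1Dx R (x - 1); rewrite [1 + _]addrC subrK => h.
by apply: le_trans (h _) _; lra.
Qed.

End Growth.

(** * The moment functional of the weight *)

(** For [a = 2 lam + 1] this is [(x p w)' / w], with [w] the weight. *)
Definition pearson_op (R : realType) (a t : R) (m : nat) (p : {poly R}) :
    {poly R} :=
  a *: p + ('X * p)^`()
  + ((2 * t) *: 'X^2 - (2 * m)%:R *: 'X^(2 * m)) * p.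

Arguments pearson_op {R}.

Section Weight.
Local Open Scope classical_set_scope.
Local Open Scope ring_scope.
Variable R : realType.
Notation mu := (@lebesgue_measure R).
Notation Rpos := (`]0, +oo[%classic : set R).

Lemma finite_poly_roots (p : {poly R}) :
  p != 0 -> finite_set ([set x | root p x] : set R).
Proof.
have [n] := ubnP (size p); elim: n p => // n IHn p sp p0.
have [->|/set0P[a /factor_theorem[q pq]]] :=
    eqVneq ([set x | root p x] : set R) set0; first exact: finite_set0.
have q0 : q != 0 by apply: contra_neq p0 => q0; rewrite pq q0 mul0r.
have sq : (size q < n)%N.
  by move: sp; rewrite pq size_Mmonic ?monicXsubC// size_XsubC addn2.
apply: (@sub_finite_set _ _ (([set x | root q x] : set R) `|` [set a])).
  by move=> x /=; rewrite pq rootM root_XsubC => /orP[?|/eqP ->]; [left|right].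
by rewrite finite_setU; split; [exact: IHn|exact: finite_set1].
Qed.

Variables (lam t : R) (m : nat).
Hypothesis lam_gt : -1 < lam.
Hypothesis m_ge2 : (2 <= m)%N.
Let w := weight lam t m.
Let E (x : R) := expR (t * x ^+ 2 - x ^+ (2 * m)).
Let a := 2 * lam + 1.
Let b := 2 * lam + 2.

Let b_gt0 : 0 < b.
Proof. by rewrite /b; move: lam_gt; lra. Qed.

Let weightE (x : R) : 0 < x -> w x = x `^ (b - 1) * E x.
Proof.
move=> x0; rewrite /w /weight gtr0_norm// (_ : b - 1 = 2 * lam + 1)//.
by rewrite /b -addrA; congr (_ + _); ring.
Qed.

Lemma weight_even (x : R) : w (- x) = w x.
Proof. by rewrite /w /weight normrN !exprM !sqrrN. Qed.

Let continuous_horner (q : {poly R}) : continuous (horner q).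
Proof.
move=> x; apply: differentiable_continuous.
exact/derivable1_diffP/derivable_horner.
Qed.

Let measurable_horner (q : {poly R}) : measurable_fun [set: R] (horner q).
Proof. by apply: continuous_measurable_fun => x; exact: continuous_horner. Qed.

Lemma measurable_poly_weight (p : {poly R}) :
  measurable_fun [set: R] (fun x => p.[x] * w x).
Proof.
apply: measurable_funM; first exact: measurable_horner.
apply: measurable_funM.
  by apply: (measurableT_comp (measurable_powR _)); exact: normr_measurable.
apply: measurableT_comp; first exact: measurable_expR.
have := measurable_horner (t *: 'X^2 - 'X^(2 * m)).
by congr measurable_fun; apply/funext => x; rewrite !hornerE.
Qed.

(* [1 - (1 + x)^-1] is [x / (1 + x)] in the form that is easiest to
   differentiate. *)
Let ratio_pow (x : R) := (1 - (1 + x)^-1) `^ b.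
Let ratio_pow' (x : R) := b * (1 - (1 + x)^-1) `^ (b - 1) * (1 + x) ^- 2.

Let ratio_bounds (x : R) : 0 < x -> 0 < 1 - (1 + x)^-1 <= 1.
Proof.
move=> x0; have x1 : 0 < 1 + x by rewrite addr_gt0.
by rewrite subr_gt0 invf_lt1// ltrDl x0 gerBl invr_ge0 ltW.
Qed.

Let ratio_powR_derive (c x : R) : 0 < x ->
  is_derive x 1 (fun y : R => (1 - (1 + y)^-1) `^ c)
    (c * (1 - (1 + x)^-1) `^ (c - 1) * (1 + x) ^- 2).
Proof.
move=> x0; have x1 : 1 + x != 0 by rewrite gt_eqF// addr_gt0.
have /andP[r0 _] := ratio_bounds _ x0.
have dr : is_derive x 1 (fun y => 1 - (1 + y)^-1) ((1 + x) ^- 2).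
  have di : is_derive x 1 (fun y : R => 1 + y) (0 + 1).
    exact: (is_deriveD (is_derive_cst (1 : R) (x : R) (1 : R))
                       (is_derive_id (x : R) (1 : R))).
  have dV := is_deriveV x1 di.
  apply: is_derive_eq (is_deriveB (is_derive_cst (1 : R) (x : R) (1 : R)) dV) _.
  by rewrite sub0r scaleNr opprK add0r /GRing.scale /= mulr1.
exact: (@is_derive1_comp R (fun z => z `^ c) (fun y => 1 - (1 + y)^-1) x _ _
  (is_derive1_powR c r0) dr).
Qed.

Let integrable_ratio_pow' : mu.-integrable Rpos (EFin \o ratio_pow').
Proof.
apply: (integrable_bounded_primitive _ ratio_pow ratio_pow'
  (ratio_powR_derive b) _ 1).
- move=> x x0.
  have cr : {for x, continuous (fun y : R => (1 - (1 + y)^-1) `^ (b - 1))}.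
    have [d _] := ratio_powR_derive (b - 1) x x0.
    by apply: differentiable_continuous; exact/derivable1_diffP.
  apply: cvgM; first by apply: cvgM => //; exact: cvg_cst.
  apply: cvgV; first by rewrite expf_neq0// gt_eqF// addr_gt0.
  by rewrite /= expr2; apply: cvgM; apply: cvgD => //; exact: cvg_cst.
- move=> x x0; rewrite /ratio_pow' mulr_ge0//.
    by rewrite mulr_ge0// ?powR_ge0// ltW.
  by rewrite invr_ge0 exprn_ge0// addr_ge0// ltW.
- move=> x x0; have /andP[r0 r1] := ratio_bounds _ x0.
  rewrite ger0_norm ?powR_ge0//.
  have := @ge0_ler_powR _ b (ltW b_gt0) _ 1 _ _ r1.
  by rewrite powR1 !nnegrE ltW// => ->.
Qed.

Let continuous_weight (x : R) : 0 < x -> {for x, continuous w}.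
Proof.
move=> x0; apply: continuousM.
  apply: (@continuous_comp _ _ _ (fun y : R => `|y|) (fun y : R => y `^ a)).
    exact: norm_continuous.
  apply: differentiable_continuous; apply/derivable1_diffP.
  by apply: derivable_powR; rewrite in_itv/= gtr0_norm// x0.
apply: continuous_comp; last exact: continuous_expR.
have := continuous_horner (t *: 'X^2 - 'X^(2 * m)) x.
by congr (continuous_at _ _); apply/funext => y; rewrite !hornerE.
Qed.

(** For [x > 0] the factor [x^(b - 1)] of the weight equals
    [(x / (1 + x))^(b - 1) (1 + x)^-2] times [(1 + x)^(b + 1)].  The former is
    [ratio_pow' x / b], and the latter is at most [expR ((b + 1) (1 + x))],
    which the exponential factor of the weight absorbs. *)
Lemma integrable_poly_weight_pos (p : {poly R}) :
  mu.-integrable Rpos (fun x => (p.[x] * w x)%:E).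
Proof.
have [C HC] := poly_exponential_bounded _ p (b + 1) t m m_ge2.
pose K := expR (b + 1) * C / b.
have iK : mu.-integrable Rpos (EFin \o (fun x => K * ratio_pow' x)).
  by apply: (integrableZl _ K integrable_ratio_pow').
apply: le_integrable iK => //.
  apply/measurable_EFinP; apply: measurable_funTS.
  exact: measurable_poly_weight.
move=> x; rewrite /= in_itv/= andbT lee_fin => x0.
have x1 : 0 < 1 + x by rewrite addr_gt0.
have /andP[r0 _] := ratio_bounds _ x0.
apply: le_trans (ler_norm _).
rewrite normrM weightE// (ger0_norm (mulr_ge0 (powR_ge0 _ _) (expR_ge0 _))).
have -> : x `^ (b - 1) =
    (1 - (1 + x)^-1) `^ (b - 1) * (1 + x) ^- 2 * (1 + x) `^ (b + 1).
  have -> : (1 + x) `^ (b + 1) = (1 + x) `^ (b - 1) * (1 + x) ^+ 2.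
    rewrite -powR_mulrn ?ltW// -powRD ?(gt_eqF x1) ?implybT//.
    by have -> : b - 1 + 2 = b + 1 by ring.
  rewrite mulrACA mulVf ?mulr1; last by rewrite expf_neq0// gt_eqF.
  rewrite -powRM ?ltW//.
  by have -> : (1 - (1 + x)^-1) * (1 + x) = x by field; rewrite gt_eqF.
rewrite /ratio_pow' /K.
have -> : expR (b + 1) * C / b
     * (b * (1 - (1 + x)^-1) `^ (b - 1) / (1 + x) ^+ 2)
   = (1 - (1 + x)^-1) `^ (b - 1) / (1 + x) ^+ 2 * (expR (b + 1) * C).
  by field; rewrite !gt_eqF.
rewrite mulrCA -!mulrA ler_wpM2l ?powR_ge0// ler_wpM2l//.
  by rewrite invr_ge0 exprn_ge0// ltW.
apply: le_trans (_ : expR (b + 1) * (`|p.[x]|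
  * expR ((b + 1) * x + t * x ^+ 2 - x ^+ (2 * m))) <= _).
  have b1 : 0 <= b + 1 by rewrite addr_ge0 ?ltW.
  have -> : expR ((b + 1) * x + t * x ^+ 2 - x ^+ (2 * m)) =
      expR ((b + 1) * x) * E x.
    by rewrite -expRD addrA.
  rewrite -/(E x) (mulrCA `|_| (expR _)) [leRHS]mulrA ler_wpM2r//.
    by rewrite mulr_ge0// expR_ge0.
  have := powR_le_expR _ (1 + x) (b + 1) x1 b1.
  by rewrite mulrDr mulr1 expRD.
by rewrite ler_wpM2l ?expR_ge0// HC// ltW.
Qed.

Let Q : {poly R} := t *: 'X^2 - 'X^(2 * m).

(* The function [x p w] on the half-line, with its two powers of [x] merged so
   that it is continuous at the origin. *)
Let boundary (p : {poly R}) (x : R) := x `^ b * (p.[x] * E x).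

Let boundary_derive (p : {poly R}) (x : R) : 0 < x ->
  is_derive x 1 (boundary p) ((pearson_op a t m p).[x] * w x).
Proof.
move=> x0.
have dE : is_derive x 1 E (E x * Q^`().[x]).
  have -> : E = expR \o horner Q.
    by apply/funext => y; rewrite /E /Q /= !hornerE.
  exact: is_derive1_comp (is_derive_expR _) (is_derive_poly Q x).
have dpE := is_deriveM (is_derive_poly p x) dE.
have H : is_derive x 1 (boundary p) _ := is_deriveM (is_derive1_powR b x0) dpE.
apply: (is_derive_eq H).
have XQ : 'X * Q^`() = (2 * t) *: 'X^2 - (2 * m)%:R *: 'X^(2 * m).
  rewrite /Q derivB derivZ !derivXn mulrBr -scalerAr !mulrnAr -!exprS.
  rewrite (@prednK (2 * m)) ?muln_gt0 ?(ltnW m_ge2)//.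
  by rewrite -[X in t *: X]scaler_nat scalerA (mulrC t) -[X in _ - X]scaler_nat.
rewrite weightE// /pearson_op -XQ derivM derivX mul1r.
rewrite -(mulr_powRB1 (ltW x0) b_gt0).
have -> : (horner p * E) x = p.[x] * E x by [].
rewrite !(hornerD, hornerM, hornerZ, hornerX).
have -> : a = b - 1 by rewrite /a /b; ring.
move: (Q^`().[x]) (p^`().[x]) (p.[x]) (E x) (x `^ (b - 1)) => q' p' p0 e y.
by rewrite /GRing.scale /=; ring.
Qed.

Let boundary_0 (p : {poly R}) : boundary p x @[x --> 0^'+] --> 0.
Proof.
have [C HC] := poly_exponential_bounded _ p 0 t m m_ge2.
apply/cvgrPdist_le => e e0.
have C0 : 0 <= C.
  exact: le_trans (mulr_ge0 (normr_ge0 _) (expR_ge0 _)) (HC 0 (lexx _)).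
have := powR_cvg0 b_gt0; move/cvgrPdist_le => /(_ (e / (C + 1))).
have eC : 0 < e / (C + 1) by rewrite divr_gt0// ltr_wpDl.
move=> /(_ eC) xe; near=> x.
have x0 : 0 < x by near: x; exact: nbhs_right_gt.
have : `|0 - x `^ b| <= e / (C + 1) by near: x.
rewrite !sub0r !normrN (ger0_norm (powR_ge0 _ _)) => xb.
rewrite /boundary !normrM.
rewrite (ger0_norm (powR_ge0 _ _)) (ger0_norm (expR_ge0 _)).
have pE : `|p.[x]| * E x <= C by have := HC x (ltW x0); rewrite mul0r add0r.
apply: le_trans (ler_pM (powR_ge0 _ _) _ xb pE) _.
  exact: mulr_ge0 (normr_ge0 _) (expR_ge0 _).
by rewrite mulrAC ler_pdivrMr ?ltr_wpDl// ler_wpM2l ?lerDl// ltW.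
Unshelve. all: by end_near. Qed.

(* One more factor [x] is still bounded, so [boundary p x = O(1/x)]. *)
Let boundary_y (p : {poly R}) : boundary p x @[x --> +oo] --> 0.
Proof.
have [C HC] := poly_exponential_bounded _ ('X * p) b t m m_ge2.
apply/cvgrPdist_le => e e0; near=> x.
have x0 : 0 < x by near: x; apply: nbhs_pinfty_gt; exact: num_real.
have xC : C / e <= x by near: x; apply: nbhs_pinfty_ge; exact: num_real.
rewrite sub0r normrN -(ler_pM2l x0).
apply: (@le_trans _ _ C); last by rewrite -ler_pdivrMr.
apply: le_trans (HC x (ltW x0)).
have -> : expR (b * x + t * x ^+ 2 - x ^+ (2 * m)) = expR (b * x) * E x.
  by rewrite -expRD addrA.
rewrite /boundary hornerM hornerX 3!normrM (gtr0_norm x0).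
rewrite (ger0_norm (powR_ge0 _ _)) (ger0_norm (expR_ge0 _)).
have b_ge0 := ltW b_gt0.
rewrite -mulrA ler_wpM2l ?(ltW x0)// [leRHS]mulrCA ler_wpM2r//.
exact: powR_le_expR.
Unshelve. all: by end_near. Qed.

Lemma Rintegral_pearson_pos (p : {poly R}) :
  \int[mu]_(x in Rpos) ((pearson_op a t m p).[x] * w x) = 0.
Proof.
rewrite (Rintegral_derivative _ (boundary p) _ (boundary_derive p) _ 0 0).
- by rewrite subrr.
- by move=> x x0; apply: continuousM;
    [exact: continuous_horner|exact: continuous_weight].
- exact: integrable_poly_weight_pos.
- exact: boundary_0.
- exact: boundary_y.
Qed.

Let reflect_poly (p : {poly R}) (x : R) :
  p.[- x] * w (- x) = (p \Po - 'X).[x] * w x.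
Proof. by rewrite weight_even horner_comp hornerN hornerX. Qed.

Let moment_symmetrize (p : {poly R}) :
  mu.-integrable [set: R] (fun x => (p.[x] * w x)%:E) /\
  moment w p = \int[mu]_(x in Rpos) ((p + (p \Po - 'X)).[x] * w x).
Proof.
have := Rintegral_symmetrize _ _ (measurable_poly_weight p).
have ip := integrable_poly_weight_pos p.
have ipN : mu.-integrable Rpos (fun x => (p.[- x] * w (- x))%:E).
  apply: eq_integrable (integrable_poly_weight_pos (p \Po - 'X)) => //.
  by move=> x _; rewrite reflect_poly.
move=> /(_ ip ipN)[ipT E1]; split => //; rewrite /moment E1.
by apply: eq_Rintegral => x _; rewrite reflect_poly -mulrDl -hornerD.
Qed.

Lemma integrable_poly_weight (p : {poly R}) :
  mu.-integrable [set: R] (fun x => (p.[x] * w x)%:E).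
Proof. by have [] := moment_symmetrize p. Qed.

Lemma moment_scalar : scalar (moment w).
Proof.
move=> k p q; have ip := integrable_poly_weight p.
rewrite /moment -RintegralZl// -RintegralD//.
- by apply: eq_Rintegral => x _; rewrite hornerD hornerZ; ring.
- exact: (integrableZl _ k ip).
- exact: integrable_poly_weight.
Qed.

(** The operator commutes with [x |-> - x], so the identity on the line is the
    half-line identity for [p (x) + p (- x)]. *)
Lemma moment_pearson (p : {poly R}) : moment w (pearson_op a t m p) = 0.
Proof.
have [_ ->] := moment_symmetrize (pearson_op a t m p).
have -> : pearson_op a t m p + (pearson_op a t m p \Po - 'X)
    = pearson_op a t m (p + (p \Po - 'X)).
  have dr : (p \Po - 'X)^`() = - (p^`() \Po - 'X).
    by rewrite deriv_comp derivN derivX mulrN mulr1.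
  have Vr : ((2 * t) *: 'X^2 - (2 * m)%:R *: 'X^(2 * m)) \Po - 'X
      = (2 * t) *: 'X^2 - (2 * m)%:R *: 'X^(2 * m) :> {poly R}.
    by rewrite comp_polyB !comp_polyZ !comp_Xn_poly !exprM !sqrrN.
  rewrite /pearson_op !comp_polyD comp_polyZ comp_polyM Vr !derivM derivX.
  rewrite comp_polyD !comp_polyM comp_polyX comp_polyC derivD dr.
  by rewrite scalerDr; ring.
exact: Rintegral_pearson_pos.
Qed.

(** Otherwise [p^2 w] would vanish almost everywhere, whereas on [`]0, 1]] it
    vanishes only at the finitely many roots of [p]. *)
Lemma moment_sqr_neq0 (p : {poly R}) : p != 0 -> moment w (p ^+ 2) != 0.
Proof.
move=> p0; apply/eqP => M0.
have mE := measurable_poly_weight (p ^+ 2).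
have f0 (x : R) : 0 <= (p ^+ 2).[x] * w x.
  by rewrite horner_exp mulr_ge0 ?sqr_ge0// mulr_ge0 ?powR_ge0 ?expR_ge0.
have : (\int[mu]_x `|((p ^+ 2).[x] * w x)%:E| = 0)%E.
  under eq_integral do rewrite /= (ger0_norm (f0 _)).
  rewrite -[LHS]fineK; first by move: M0; rewrite /moment /Rintegral => ->.
  by apply: integrable_fin_num => //; exact: integrable_poly_weight.
move/ae_eq_integral_abs => /(_ measurableT).
have mEE : measurable_fun [set: R] (fun x => ((p ^+ 2).[x] * w x)%:E).
  exact/measurable_EFinP.
move=> /(_ mEE)[N [mN N0 subN]].
pose Z : set R := [set x | root p x].
have Z0 : mu Z = 0.
  exact/countable_lebesgue_measure0/finite_set_countable/finite_poly_roots.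
have sub : `]0, 1] `<=` N `|` Z.
  move=> x; rewrite /= in_itv/= => /andP[x0 _].
  have [rx|/negP nrx] := boolP (root p x); [by right|left; apply: subN => /=].
  move=> /(_ I)[] /eqP; rewrite horner_exp mulf_eq0 sqrf_eq0; apply/negP.
  rewrite negb_or; apply/andP; split; first exact/negP.
  by rewrite weightE// mulf_neq0// gt_eqF// ?powR_gt0// expR_gt0.
have mZ : measurable Z.
  have -> : Z = ([set: R] `&` (horner p : R -> R) @^-1` [set (0 : R)]
      : set R).
    by apply/seteqP; split=> [x /rootP px|x [_ px]]; [split|apply/rootP].
  exact: measurable_horner.
have : (mu `]0%R, 1%R] <= mu (N `|` Z))%E.
  apply: le_measure => //; rewrite inE; first exact: measurable_itv.
  exact: measurableU.
have NZ0 : (mu (N `|` Z) <= 0)%E.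
  apply: (le_trans (measureU2 _ mN mZ)).
  have N0' : mu N = 0%E by exact: N0.
  by rewrite [X in (X + _)%E]N0' [X in (_ + X)%E]Z0 adde0.
move/le_trans => /(_ _ NZ0).
by rewrite lebesgue_measure_itv /= lte01 oppr0 adde0 lee_fin ler10.
Qed.

End Weight.

(** * Orthogonal polynomials for a functional with a Pearson equation *)

Section OrthogonalPolynomials.
Variables (R : realType) (L : {scalar {poly R}}) (P : nat -> {poly R}).
Hypothesis P_monic : forall n, P n \is monic.
Hypothesis size_P : forall n, size (P n) = n.+1.
Hypothesis P_orth : forall i j, i != j -> L (P i * P j) = 0.

Let coefPn n : (P n)`_n = 1.
Proof.
by rewrite -[n in _`_n]/(n.+1.-1) -(size_P n) -lead_coefE; exact/monicP.
Qed.

Lemma orthogonal_lower n (r : {poly R}) : (size r <= n)%N -> L (P n * r) = 0.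
Proof.
suff H k : (k <= n)%N ->
    forall q : {poly R}, (size q <= k)%N -> L (P n * q) = 0.
  exact: (H n).
elim: k => [_ q|k IHk ltkn q sq].
  by rewrite leqn0 size_poly_eq0 => /eqP->; rewrite mulr0 linear0.
have -> : q = q`_k *: P k + (q - q`_k *: P k) by rewrite addrC subrK.
rewrite mulrDr linearD /= -scalerAr linearZ /= P_orth ?gtn_eqF// mulr0 add0r.
apply: IHk; first exact: ltnW.
apply/leq_sizeP => j; rewrite leq_eqVlt => /predU1P[<-|ltkj].
  by rewrite coefB coefZ coefPn mulr1 subrr.
rewrite coefB coefZ (leq_sizeP _ _ sq)//.
by rewrite [(P k)`_j]nth_default ?size_P// mulr0 subr0.
Qed.

Lemma orthogonal_lead n (r : {poly R}) : (size r <= n.+1)%N ->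
  L (P n * r) = r`_n * L (P n ^+ 2).
Proof.
move=> sr; have -> : r = r`_n *: P n + (r - r`_n *: P n) by rewrite addrC subrK.
rewrite mulrDr linearD /= -scalerAr linearZ /= -expr2.
rewrite coefD coefB coefZ coefPn mulr1 subrr addr0 orthogonal_lower ?addr0//.
apply/leq_sizeP => j; rewrite leq_eqVlt => /predU1P[<-|ltnj].
  by rewrite coefB coefZ coefPn mulr1 subrr.
rewrite coefB coefZ (leq_sizeP _ _ sr)//.
by rewrite [(P n)`_j]nth_default ?size_P// mulr0 subr0.
Qed.

Variable beta : nat -> R.
Hypothesis P_rec : recurrence_coefs P beta.

Let P_recS n : P n.+2 = 'X * P n.+1 - beta n.+1 *: P n.
Proof. by case: P_rec => _ /(_ n.+1). Qed.

(** At [0] the recurrence reads [P (n + 2) = - beta (n + 1) P n]. *)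
Lemma odd_degree_root0 n : odd n -> (P n).[0] = 0.
Proof.
have [b0 Pr] := P_rec.
case: n => // n; have [k] := ubnP n; elim: k n => // k IHk [_ _|[//|n]].
  by rewrite Pr b0 scale0r subr0 hornerM hornerX mul0r.
rewrite ltnS => nk; rewrite /= negbK => on.
by rewrite P_recS !hornerE IHk ?(ltnW nk) ?mulr0 ?oppr0 ?addr0.
Qed.

(** Expand [L (P n * P n.+2) = 0] with the recurrence for [P n.+2]. *)
Lemma sqnorm_recurrence n : L (P n.+1 ^+ 2) = beta n.+1 * L (P n ^+ 2).
Proof.
have : L (P n * P n.+2) = 0 by apply: P_orth; rewrite ltn_eqF.
rewrite P_recS mulrBr linearB /= -scalerAr linearZ /= -expr2 => /eqP.
rewrite subr_eq0 => /eqP <-.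
rewrite mulrCA mulrA mulrC (@orthogonal_lead n.+1 ('X * P n)); last first.
  by rewrite mulrC size_mulX ?size_P// -size_poly_eq0 size_P.
by rewrite coefXM /= coefPn mul1r.
Qed.

Variables (a t : R) (m : nat).
Hypothesis m_gt0 : (0 < m)%N.
Hypothesis pearson : forall q : {poly R}, L (pearson_op a t m q) = 0.
Hypothesis L_sqr : forall q, q != 0 -> L (q ^+ 2) != 0.

(** The factor of odd degree, which vanishes at [0], is the one divided by [x].
    If it is [P n.+1], the quotient is monic of degree [n] and pairs with [P n]
    to give its square norm; if it is [P n], the quotient has degree less than
    [n.+1] and is orthogonal to [P n.+1]. *)
Lemma consecutive_product_over_X n : exists2 q : {poly R},
  P n.+1 * P n = 'X * q & L q = (odd n.+1)%:R * L (P n ^+ 2).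
Proof.
have factX k : odd k -> exists q, P k = q * 'X.
  move/odd_degree_root0/eqP; rewrite -/(root _ 0) => /factor_theorem[q ->].
  by exists q; rewrite subr0.
case: (boolP (odd n.+1)) => on.
  have [q Pq] := factX _ on; exists (P n * q).
    by rewrite Pq mulrAC mulrC [q * _]mulrC.
  have qn : q`_n = 1 by have := coefPn n.+1; rewrite Pq coefMX.
  rewrite orthogonal_lead ?qn//.
  have := size_P n.+1; rewrite Pq size_mulX ?ltnS; first by case=> ->.
  by apply: contra_eq_neq qn => ->; rewrite coef0 eq_sym oner_eq0.
have [q Pq] := factX n ltac:(by move: on; rewrite /= negbK).
exists (P n.+1 * q); first by rewrite Pq mulrA mulrC.
rewrite mul0r orthogonal_lower//.
have : (size (q * 'X)%R <= n.+1)%N by rewrite -Pq size_P.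
have [->|q0] := eqVneq q 0; first by rewrite size_poly0.
by rewrite size_mulX// => /leqW.
Qed.

Lemma derivative_of_consecutive_product n :
  L ((P n.+1 * P n)^`()) = n.+1%:R * L (P n ^+ 2).
Proof.
rewrite derivM linearD /= (mulrC _ (P n)).
rewrite (@orthogonal_lead n (P n.+1)^`()); last first.
  rewrite -ltnS; apply: leq_trans (lt_size_deriv _) _.
    by rewrite -size_poly_eq0 size_P.
  by rewrite size_P.
rewrite coef_deriv coefPn orthogonal_lower ?addr0//.
by apply: leq_trans (size_poly _ _) _; rewrite size_P.
Qed.

(** The Pearson identity for the quotient [q] of [P n.+1 * P n] by [x]: the
    products [x^2 q] and [x^(2m) q] no longer involve the division. *)
Lemma pearson_consecutive n :
  (2 * m)%:R * L ('X^(2 * m - 1) * (P n.+1 * P n)) - 2 * t * L (P n.+1 ^+ 2)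
  = (n.+1%:R + a * (odd n.+1)%:R) * L (P n ^+ 2).
Proof.
have [q PPq Lq] := consecutive_product_over_X n.
have LX : L (P n.+1 * ('X * P n)) = L (P n.+1 ^+ 2).
  rewrite (@orthogonal_lead n.+1 ('X * P n)); last first.
    by rewrite mulrC size_mulX ?size_P// -size_poly_eq0 size_P.
  by rewrite coefXM /= coefPn mul1r.
have X2q : 'X^2 * q = P n.+1 * ('X * P n).
  by rewrite mulrCA PPq mulrA -expr2.
have X2mq : 'X^(2 * m) * q = 'X^(2 * m - 1) * (P n.+1 * P n).
  by rewrite PPq mulrA -exprSr subn1 prednK// muln_gt0.
have opE : pearson_op a t m q = a *: q + (P n.+1 * P n)^`()
    + ((2 * t) *: (P n.+1 * ('X * P n))
       + (- (2 * m)%:R) *: ('X^(2 * m - 1) * (P n.+1 * P n))).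
  by rewrite /pearson_op mulrBl -!scalerAl X2q X2mq -PPq scaleNr.
have E := pearson q.
rewrite opE !linearD /= !linearZ /= LX Lq in E.
rewrite derivative_of_consecutive_product in E.
by apply/eqP; rewrite eq_sym -subr_eq0 -[X in _ == X]E; apply/eqP; ring.
Qed.

Variable w : R -> R.
Hypothesis L_moment : forall q, L q = moment w q.

(** This is [pearson_consecutive] divided by the square norm of [P n.-1].  The
    product [x P n.-1] is expanded by the recurrence, and [sqnorm_recurrence]
    turns the quotients of square norms into the normalizations of [Ccoef]. *)
Lemma discrete_equation n :
  (2 * m)%:R * Vcoef w P beta m n - 2 * t * beta n
  = n%:R + a * (odd n)%:R.
Proof.
have nz k : L (P k ^+ 2) != 0 by rewrite L_sqr// -size_poly_eq0 size_P.
have [b0 Prec] := P_rec.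
case: n => [|n].
  by rewrite /Vcoef /Ccoef /= b0 !(mul0r, mulr0) !addr0 mulr0 subr0.
have bS := sqnorm_recurrence n.
have b1 : beta n.+1 != 0.
  by apply: contra_eq_neq bS => ->; rewrite mul0r nz.
have E := pearson_consecutive n.
have X2m : 'X^(2 * m - 1) * (P n.+1 * P n)
    = 'X^(2 * m - 2) * P n.+1 * P n.+1
      + beta n *: (if n is n'.+1 then 'X^(2 * m - 2) * P n' * P n.+1 else 0).
  have -> : 'X^(2 * m - 1) = 'X^(2 * m - 2) * 'X :> {poly R}.
    by rewrite -exprSr subnSK// leq_pmulr.
  rewrite mulrACA.
  have -> : 'X * P n = P n.+1 + beta n *: (if n is n'.+1 then P n' else 0).
    by rewrite Prec subrK.
  rewrite mulrDr -scalerAr; congr (_ + _ *: _).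
  by case: (n) => [|n']; rewrite ?mulr0// mulrAC.
apply: (mulIf (nz n)); have hn := nz n.
rewrite -E X2m [L (_ + _)]linearD /= [L (_ *: _)]linearZ /= bS.
rewrite /Vcoef /Ccoef /sqnorm -!L_moment bS.
case: n => [|n] in bS b1 E X2m hn *.
  (* At [n = 1] the index [n - 2] is negative, and [P 0] has no predecessor. *)
  by rewrite (_ : 1%:Z - 2 = Negz 0)// linear0 /=; field; rewrite b1 hn.
have -> : n.+2%:Z - 2 = n by rewrite -addn2 PoszD addrK.
rewrite -!L_moment; have bS' := sqnorm_recurrence n.
have b1' : beta n.+1 != 0.
  by apply: contra_eq_neq bS' => ->; rewrite mul0r nz.
by rewrite bS'; field; rewrite b1 b1' nz.
Qed.

End OrthogonalPolynomials.

Theorem proposition4p4 (R : realType) (lam t : R) (m : nat)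
    (P : nat -> {poly R}) (beta : nat -> R)
    (hlam : -1 < lam) (hm : (2 <= m)%N)
    (hP : monic_orthogonal (weight lam t m) P)
    (hbeta : recurrence_coefs P beta) (n : nat) :
  (2 * m)%:R * Vcoef (weight lam t m) P beta m n - 2 * t * beta n
    = n%:R + (lam + 1 / 2) * (1 - (-1) ^+ n).
Proof.
have [Pmonic Psize Porth] := hP.
pose L : {scalar {poly R}} := HB.pack (moment (weight lam t m))
  (GRing.isLinear.Build R {poly R} R *%R _ (moment_scalar R lam t m hlam hm)).
have -> : n%:R + (lam + 1 / 2) * (1 - (-1) ^+ n)
    = n%:R + (2 * lam + 1) * (odd n)%:R :> R.
  by rewrite -signr_odd; case: (odd n); rewrite /= ?expr0 ?expr1; field.
apply: (discrete_equation R L P Pmonic Psize Porth beta hbeta) => //.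
- exact: ltnW.
- exact: moment_pearson.
- exact: moment_sqr_neq0.
Qed.
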